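(* Let $\mathcal{S}=\{S_1,\ldots,S_N\}$ be a family of integer sets over the universe $[0..u)$, each $S_i$ stored as its binary trie $\mathrm{bintrie}(S_i)$. Let $\mathcal{Q}=\{i_1,\ldots,i_k\}\subseteq[1..N]$ be a query instance with alternation measure $\delta$. Then the algorithm $\texttt{TP-Intersection}$ computes $\mathcal{I}(\mathcal{Q})=\bigcap_{i\in\mathcal{Q}}S_i$ in time $O(k\,\delta\lg(u/\delta))$.
   Context: Model: word RAM with word size $w=\Theta(\lg u)$. Let $\ell=\lceil\lg u\rceil$. For a set $S\subseteq[0..u)$, $\mathrm{bintrie}(S)$ is the binary trie obtained by inserting the $\ell$-bit binary encodings (most significant bit first) of all elements of $S$; only paths leading to elements exist, and all leaves are at depth $\ell$, one per element. The algorithm $\texttt{TP-Intersection}(S_1,\ldots,S_k;[L..R))$ (Trabb-Pardo): if some $S_i$ is empty return $\varnothing$; if $L=R$ return $\{L\}$; otherwise let $M=(L+R)/2$, split each $S_i$ into $S_{i,l}=S_i\cap[L..M)$ and $S_{i,r}=S_i\cap[M..R)$, recursively compute the intersections on $[L..M)$ and $[M..R)$ and return their union; $\mathcal{I}(\mathcal{Q})$ is computed by calling it with the query sets and universe $[0..u)$. On binary tries this is a synchronized depth-first traversal of $\mathrm{bintrie}(S_{i_1}),\ldots,\mathrm{bintrie}(S_{i_k})$ following the same path in all of them, backtracking as soon as a child is missing in one trie, and reporting an element when a leaf is reached in all tries. A partition certificate of $\mathcal{Q}$ is a partition $\mathcal{P}$ of $[0..u)$ into intervals such that (1) for every $x\in\mathcal{I}(\mathcal{Q})$,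 the singleton $[x..x]\in\mathcal{P}$; (2) for every $x\notin\mathcal{I}(\mathcal{Q})$ there is $I_j\in\mathcal{P}$ with $x\in I_j$ and some $q\in\mathcal{Q}$ with $S_q\cap I_j=\emptyset$. The alternation measure $\delta$ of $\mathcal{Q}$ is the size of the smallest partition certificate of $\mathcal{Q}$.
   Formalization: The factor lg(u/δ) is read as max{1, lg(u/δ)}, since the literal bound is 0 when all sets equal [0..u) (δ = u); the base case is a one-element range instead of L = R, and the top call is on [0..2^⌈lg u⌉), the trie root's range. *)

(* Defs.v *)
From HB Require Import structures.
From mathcomp Require Import all_boot all_order all_algebra.
From mathcomp Require Import all_classical all_reals all_analysis.

Set Implicit Arguments.
Unset Strict Implicit.
Unset Printing Implicit Defensive.

Import Order.TTheory GRing.Theory Num.Theory.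
Import numFieldNormedType.Exports.

Definition lg (R : realType) (x : R) : R := (ln x / ln 2)%R.

(** * Binary tries *)

Inductive trie := Empty | Leaf | Node of trie & trie.

Definition lchild (t : trie) : trie := if t is Node l _ then l else Empty.
Definition rchild (t : trie) : trie := if t is Node _ r then r else Empty.

(* The l-bit encoding of x, most significant bit first. *)
Fixpoint bits (l x : nat) : seq bool :=
  if l is l'.+1 then odd (x %/ 2 ^ l') :: bits l' x else [::].

Fixpoint insert (s : seq bool) (t : trie) : trie :=
  match s with
  | [::] => Leaf
  | false :: s' => Node (insert s' (lchild t)) (rchild t)
  | true :: s' => Node (lchild t) (insert s' (rchild t))
  end.

(* The ceiling of lg u. *)
Definition height (u : nat) : nat := up_log 2 u.

Definition bintrie (u : nat) (A : {set 'I_u}) : trie :=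
  foldr (fun x : 'I_u => insert (bits (height u) x)) Empty (enum A).

(** * Partition certificates and the alternation measure *)

Definition inter (u N : nat) (S : 'I_N -> {set 'I_u}) (Q : {set 'I_N}) :
    {set 'I_u} :=
  \bigcap_(i in Q) S i.

Definition interval (u : nat) (I : {set 'I_u}) : Prop :=
  exists a b : 'I_u, I = [set x : 'I_u | a <= x <= b].

(* [finset.partition] already requires the blocks to be nonempty. *)
Definition partition_certificate (u N : nat) (S : 'I_N -> {set 'I_u})
    (Q : {set 'I_N}) (P : {set {set 'I_u}}) : Prop :=
  [/\ finset.partition P [set: 'I_u],
      forall I, I \in P -> interval I,
      forall x, x \in inter S Q -> [set x] \in P
    & forall x, x \notin inter S Q ->
        exists I, [/\ I \in P, x \in I
                    & exists q, q \in Q /\ S q :&: I = finset.set0] ].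

Definition alternation_measure (u N : nat) (S : 'I_N -> {set 'I_u})
    (Q : {set 'I_N}) (delta : nat) : Prop :=
  (exists P, partition_certificate S Q P /\ #|P| = delta) /\
  (forall P, partition_certificate S Q P -> delta <= #|P|).

(** * Word RAM with w-bit words *)

(* A memory maps addresses to words. A computation takes the word size and a
   memory, and either fails or yields a value, the final memory and the number
   of elementary instructions executed. Addresses and results that do not fit
   in a w-bit word make the computation fail instead of wrapping around, so a
   successful computation is one of the usual (modular) word RAM. *)
Definition memory := nat -> nat.
Definition ram (A : Type) := nat -> memory -> option (A * memory * nat).

Definition ret (A : Type) (a : A) : ram A := fun _ m => Some (a, m, 0).

Definition bind (A B : Type) (c : ram A) (f : A -> ram B) : ram B := fun w m =>
  if c w m is Some (a, m1, t1) then
    if f a w m1 is Some (b, m2, t2) then Some (b, m2, t1 + t2) else None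
  else None.

Notation "'let*' x ':=' c 'in' d" := (bind c (fun x => d))
  (at level 200, x name, c at level 100, d at level 200).
Notation "'do*' c 'in' d" := (bind c (fun _ => d))
  (at level 200, c at level 100, d at level 200).

Definition fail (A : Type) : ram A := fun _ _ => None.
Arguments fail {A}.

(* The instructions; each one costs 1. *)
Definition alu (v : nat) : ram nat := fun w m =>
  if v < 2 ^ w then Some (v, m, 1) else None.
Definition add (a b : nat) : ram nat := alu (a + b).
Definition sub (a b : nat) : ram nat := if b <= a then alu (a - b) else fail.
Definition half (a : nat) : ram nat := alu a./2.
Definition test_eq (a b : nat) : ram bool := fun _ m => Some (a == b, m, 1).
Definition load (a : nat) : ram nat := fun w m =>
  if a < 2 ^ w then Some (m a, m, 1) else None.
Definition store (a v : nat) : ram unit := fun w m =>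
  if (a < 2 ^ w) && (v < 2 ^ w)
  then Some (tt, fun b => if b == a then v else m b, 1) else None.
Definition call : ram unit := fun _ m => Some (tt, m, 1).

(** * TP-Intersection on binary tries *)

(* In every recursive function below, [fuel] only serves to bound the recursion
   depth: running out of it is a failure, and it plays no role in the time.
   A frame is a block of k consecutive cells with one node pointer per trie; the
   null pointer is 0. The frames of the recursive calls form a stack. *)

(* Tests that none of the pointers j, ..., k - 1 of a frame is null. *)
Fixpoint all_nonnull (fuel j k frame : nat) : ram bool :=
  if fuel is n.+1 then
    let* b := test_eq j k in
    if b then ret true else
    let* a := add frame j in
    let* p := load a in
    let* z := test_eq p 0 in
    if z then ret false else
    let* j' := add j 1 in
    all_nonnull n j' k frame
  else fail.

(* Moves from the nodes of [frame] to their left (side = 0) or right (side = 1)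
   children, which are written in [frame']. *)
Fixpoint descend (fuel side j k frame frame' : nat) : ram unit :=
  if fuel is n.+1 then
    let* b := test_eq j k in
    if b then ret tt else
    let* a := add frame j in
    let* p := load a in
    let* a1 := add p side in
    let* c := load a1 in
    let* a' := add frame' j in
    do* store a' c in
    let* j' := add j 1 in
    descend n side j' k frame frame'
  else fail.

(* TP-Intersection on the range [L..R), applied to the k subtries whose roots
   are in [frame]. The elements found are written from address [out] on; the
   returned value is the first address after them. *)
Fixpoint tp_rec (fuel k frame L R out : nat) : ram nat :=
  if fuel is n.+1 then
    do* call in
    let* ne := all_nonnull n 0 k frame in
    if ~~ ne then ret out else
    let* d := sub R L in
    let* b := test_eq d 1 in
    if b then
      do* store out L in
      add out 1
    else
      let* s := add L R in
      let* M := half s in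
      let* frame' := add frame k in
      do* descend n 0 0 k frame frame' in
      let* out' := tp_rec n k frame' L M out in
      do* descend n 1 0 k frame frame' in
      tp_rec n k frame' M R out'
  else fail.

(* Collects in [frame] the roots of the queried tries: the array at [qry] holds
   the k query indices, the array at [tbl] the roots of the N tries. *)
Fixpoint load_roots (fuel j k tbl qry frame : nat) : ram unit :=
  if fuel is n.+1 then
    let* b := test_eq j k in
    if b then ret tt else
    let* a := add qry j in
    let* i := load a in
    let* a1 := add tbl i in
    let* p := load a1 in
    let* a' := add frame j in
    do* store a' p in
    let* j' := add j 1 in
    load_roots n j' k tbl qry frame
  else fail.

(* [U] is the size 2 ^ height u of the range of the trie roots. *)
Definition tp_intersection (fuel k U tbl qry stk out : nat) : ram nat :=
  do* load_roots fuel 0 k tbl qry stk in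
  tp_rec fuel k stk 0 U out.

(** * Input layout *)

(* The pointer [p] represents the trie [t]: an internal node at [p] has its left
   and right child pointers at [p] and [p + 1]. All nodes lie below [bnd]. *)
Fixpoint trie_at (m : memory) (bnd p : nat) (t : trie) : bool :=
  match t with
  | Empty => p == 0
  | Leaf => 0 < p < bnd
  | Node l r => [&& 0 < p, p.+1 < bnd, trie_at m bnd (m p) l
                                     & trie_at m bnd (m p.+1) r]
  end.

(* The input lies below [stk], the stack between [stk] and [out], and all the
   addresses and integers involved fit in a word. *)
Record stored (w u N : nat) (S : 'I_N -> {set 'I_u}) (Q : {set 'I_N})
    (m : memory) (tbl qry stk out : nat) : Prop := Stored {
  stored_word : forall a, m a < 2 ^ w;
  stored_tries : tbl + N <= stk /\
    forall i : 'I_N, trie_at m stk (m (tbl + i)) (bintrie (S i));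
  stored_query : qry + #|Q| <= stk /\
    perm_eq [seq m (qry + j) | j <- iota 0 #|Q|] [seq val i | i <- enum Q];
  stored_stack : stk + (height u).+1 * #|Q| <= out;
  stored_out : out + #|inter S Q| < 2 ^ w;
  stored_univ : 2 * 2 ^ height u <= 2 ^ w
}.

(* Main.v *)
Require Import Defs.
From HB Require Import structures.
From mathcomp Require Import all_boot all_order all_algebra.
From mathcomp Require Import all_classical all_reals all_analysis.
From mathcomp Require Import zify ring lra.
Import Order.TTheory GRing.Theory Num.Theory.
Import numFieldNormedType.Exports.

(** Call a node of the complete binary trie of height [H := height u] alive if
    its range meets all the queried sets. Every call of the recursion costs
    [O(k)], and the nodes reached are the alive ones and some of their children.
    A level of depth [d] has at most [2 ^ d] alive nodes, and at most [delta]: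
    the block of a certificate that contains the least point of the range
    determines the node among the alive ones of its level. Summing
    [min (2 ^ d) delta] over [d <= H] gives at most
    [delta * (H - D + 2)] with [D] the integer part of [lg delta], that is
    [O(delta * lg (u / delta))]. *)

(** * Binary tries described by dyadic ranges *)

Definition occupied (h L : nat) (A : pred nat) : bool := has A (iota L (2 ^ h)).

Lemma occupiedP h L (A : pred nat) :
  reflect (exists2 x, L <= x < L + 2 ^ h & A x) (occupied h L A).
Proof.
apply: (iffP hasP) => -[x].
  by rewrite mem_iota => hx Ax; exists x.
by move=> hx Ax; exists x; rewrite ?mem_iota.
Qed.

Lemma iota_double h L :
  iota L (2 ^ h.+1) = iota L (2 ^ h) ++ iota (L + 2 ^ h) (2 ^ h).
Proof. by rewrite expnS mul2n -addnn iotaD. Qed.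

Lemma occupiedS h L A :
  occupied h.+1 L A = occupied h L A || occupied h (L + 2 ^ h) A.
Proof. by rewrite /occupied iota_double has_cat. Qed.

(** The trie of the points of [A] in [[L, L + 2 ^ h)], defined by halving the range. Unlike
    [bintrie] it depends on no insertion order, and its children are again of this form. *)
Fixpoint subtrie (h L : nat) (A : pred nat) : trie :=
  if occupied h L A then
    if h is h'.+1 then Node (subtrie h' L A) (subtrie h' (L + 2 ^ h') A)
    else Leaf
  else Defs.Empty.

Lemma eq_subtrie h L (A B : pred nat) :
  (forall x, L <= x < L + 2 ^ h -> A x = B x) -> subtrie h L A = subtrie h L B.
Proof.
elim: h L => [|h IH] L AB /=.
  rewrite /occupied (@eq_in_has _ _ B) // => x.
  by rewrite mem_iota => /AB.
have -> : occupied h.+1 L A = occupied h.+1 L B.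
  by apply: eq_in_has => x; rewrite mem_iota => /AB.
move: AB; rewrite expnS => AB.
by rewrite (IH L) ?(IH (L + 2 ^ h)) // => x hx; apply: AB; lia.
Qed.

Lemma subtrie_unoccupied h L A : ~~ occupied h L A -> subtrie h L A = Defs.Empty.
Proof. by case: h => [|h] /= /negbTE ->. Qed.

Lemma children_subtrie h L A :
  (lchild (subtrie h.+1 L A) = subtrie h L A) *
  (rchild (subtrie h.+1 L A) = subtrie h (L + 2 ^ h) A).
Proof.
rewrite /=; case: ifP => //=.
by move/negbT; rewrite occupiedS negb_or => /andP[/subtrie_unoccupied -> /subtrie_unoccupied ->].
Qed.

(** Since the range starts at a multiple of [2 ^ h], the leading bit of [x] is the parity of the
    quotient of [x] by half the range length, so it tells which half contains [x]. The points of the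
    other half differ from [x], so that child is unchanged. *)
Lemma insert_subtrie h c x (A : pred nat) :
  c * 2 ^ h <= x < c * 2 ^ h + 2 ^ h ->
  Defs.insert (bits h x) (subtrie h (c * 2 ^ h) A) =
  subtrie h (c * 2 ^ h) (fun y => (y == x) || A y).
Proof.
elim: h c => [|h IH] c hx.
  rewrite [LHS]/= [RHS]/=; case: (occupiedP 0 (c * 2 ^ 0) _) => // -[].
  by exists x; rewrite ?eqxx.
rewrite [RHS]/=; case: occupiedP => [_|[]]; last by exists x; rewrite ?eqxx.
rewrite [LHS]/=.
have hL : c * 2 ^ h.+1 = c.*2 * 2 ^ h by rewrite expnS; lia.
have hM : c * 2 ^ h.+1 + 2 ^ h = c.*2.+1 * 2 ^ h by rewrite expnS; lia.
have p0 : 0 < 2 ^ h by rewrite expn_gt0.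
have [xM|Mx] := ltnP x (c.*2.+1 * 2 ^ h).
  have -> : x %/ 2 ^ h = c.*2.
    apply/eqP; rewrite eqn_leq leq_divRL // -ltnS ltn_divLR // xM /=; lia.
  rewrite odd_double !children_subtrie hM hL IH; last by lia.
  congr Node; apply: eq_subtrie => y hy.
  by rewrite (_ : (y == x) = false) //; lia.
have -> : x %/ 2 ^ h = c.*2.+1.
  apply/eqP; rewrite eqn_leq leq_divRL // -ltnS ltn_divLR // Mx andbT.
  move: hx; rewrite expnS; lia.
rewrite /= odd_double !children_subtrie hM hL IH; last first.
  by rewrite Mx /=; move: hx; rewrite expnS; lia.
congr Node; apply: eq_subtrie => y hy.
by rewrite (_ : (y == x) = false) //; lia.
Qed.

Definition elems {u : nat} (A : {set 'I_u}) : seq nat := [seq val x | x <- enum A].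

Lemma elems_uniq u (A : {set 'I_u}) : uniq (elems A).
Proof. by rewrite map_inj_uniq ?enum_uniq //; exact: val_inj. Qed.

Lemma mem_elems u (A : {set 'I_u}) (x : 'I_u) : (val x \in elems A) = (x \in A).
Proof. by rewrite mem_map ?mem_enum //; exact: val_inj. Qed.

Lemma elemsP u (A : {set 'I_u}) (n : nat) :
  reflect (exists2 x : 'I_u, x \in A & n = x) (n \in elems A).
Proof.
apply: (iffP mapP) => -[x hx ->]; exists x => //; move: hx; by rewrite mem_enum.
Qed.

Lemma leq_height u : u <= 2 ^ height u.
Proof. by rewrite /height up_logP. Qed.

Lemma bintrie_subtrie u (A : {set 'I_u}) :
  bintrie A = subtrie (height u) 0 (mem (elems A)).
Proof.
rewrite /bintrie /elems; elim: (enum A) => [|x s IH] /=.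
  by rewrite subtrie_unoccupied //; apply/occupiedP => -[].
rewrite IH; have := @insert_subtrie (height u) 0 x (mem [seq val y | y <- s]).
rewrite mul0n => ->; first exact: eq_subtrie.
by rewrite add0n /= (leq_trans (ltn_ord x)) ?leq_height.
Qed.

(** * Tries in memory, instructions and loops over a frame *)

(** All node cells lie below [bnd], so writing on the stack or in the output does not disturb the
    tries. *)
Lemma trie_at_eq (m m' : memory) bnd p t :
  (forall a, a < bnd -> m' a = m a) -> trie_at m bnd p t -> trie_at m' bnd p t.
Proof.
move=> mm; elim: t p => [|//|l IHl r IHr] p //= /and4P[p0 pb hl hr].
by rewrite p0 pb !mm ?IHl ?IHr //; lia.
Qed.

(** Leaves and internal nodes have positive addresses; hence the null test of the algorithm is the
    emptiness test on the current range. *)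
Lemma subtrie_null m bnd p h L A :
  trie_at m bnd p (subtrie h L A) -> (p != 0) = occupied h L A.
Proof.
case: h => [|h] /=; case: ifP => _ /=; first by case/andP; case: p.
- by move/eqP->.
- by case/and4P; case: p.
- by move/eqP->.
Qed.

Lemma addE w m a b : a + b < 2 ^ w -> Defs.add a b w m = Some (a + b, m, 1).
Proof. by rewrite /Defs.add /alu => ->. Qed.

Lemma subE w m a b : b <= a < 2 ^ w -> Defs.sub a b w m = Some (a - b, m, 1).
Proof.
case/andP=> ba aw; rewrite /Defs.sub ba /alu ifT //.
exact: leq_ltn_trans (leq_subr _ _) aw.
Qed.

Lemma halfE w m a : a < 2 ^ w -> Defs.half a w m = Some (a./2, m, 1).
Proof. by move=> aw; rewrite /Defs.half /alu ifT // (leq_ltn_trans _ aw) // -divn2 leq_div. Qed.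

Lemma loadE w m a : a < 2 ^ w -> load a w m = Some (m a, m, 1).
Proof. by rewrite /load => ->. Qed.

Definition upd (m : memory) (a v : nat) : memory :=
  fun b => if b == a then v else m b.

Lemma storeE w m a v : a < 2 ^ w -> v < 2 ^ w ->
  store a v w m = Some (tt, upd m a v, 1).
Proof. by rewrite /store => -> ->. Qed.

(** A full iteration costs 5, an exit on a null pointer 4, and the final test 1. The bound is
    written [j + d] so that the induction can advance [j] with the end fixed. *)
Lemma all_nonnullE w m frame n j d : d < n -> frame + (j + d) < 2 ^ w ->
  exists t, all_nonnull n j (j + d) frame w m =
            Some (all (fun i => m (frame + i) != 0) (iota j d), m, t)
         /\ t <= 5 * d + 1.
Proof.
elim: n j d => [//|n IH] j [|d] hd hw.
  exists 1; split=> //; rewrite /= /bind /= addn0 eqxx /=; by [].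
have ne : (j == j + d.+1) = false by lia.
have e1 : Defs.add frame j w m = Some (frame + j, m, 1) by apply: addE; lia.
have e2 : load (frame + j) w m = Some (m (frame + j), m, 1) by apply: loadE; lia.
rewrite [iota _ _]/=; rewrite [all _ _]/=.
have [z|nz] := eqVneq (m (frame + j)) 0.
  exists 4; split; last by lia.
  by rewrite /= /bind /= ne e1 e2 /= z.
have [|t [et ht]] := IH j.+1 d hd; first by lia.
exists (4 + (1 + t)); split; last by lia.
rewrite /= /bind /= ne e1 e2 /= (negbTE nz) addE; last by lia.
by rewrite addn1 -(addSnnS j d) et.
Qed.

(** An iteration executes 8 instructions. The frame read and the child cells both lie below
    [frame'], where nothing is written, so each child is read with its original value. *)
Lemma descendE w side frame frame' n j d (m : memory) :
  d < n -> frame + (j + d) <= frame' -> frame' + (j + d) < 2 ^ w ->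
  (forall a, m a < 2 ^ w) ->
  (forall i, j <= i < j + d -> m (frame + i) + side < frame') ->
  exists m' t,
    [/\ descend n side j (j + d) frame frame' w m = Some (tt, m', t),
        t <= 8 * d + 1,
        forall i, j <= i < j + d ->
          m' (frame' + i) = m (m (frame + i) + side),
        forall a, ~~ (frame' + j <= a < frame' + (j + d)) -> m' a = m a
      & forall a, m' a < 2 ^ w].
Proof.
elim: n j d m => [//|n IH] j [|d] m hd hf hw mw hp.
  exists m, 1; split=> //; first by rewrite /= /bind /= addn0 eqxx.
  by move=> i; lia.
have ne : (j == j + d.+1) = false by lia.
have e1 : Defs.add frame j w m = Some (frame + j, m, 1) by apply: addE; lia.
have e2 : load (frame + j) w m = Some (m (frame + j), m, 1) by apply: loadE; lia.
have pj := hp j ltac:(lia).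
have e3 : Defs.add (m (frame + j)) side w m = Some (m (frame + j) + side, m, 1).
  by apply: addE; lia.
set c := m (m (frame + j) + side).
have e4 : load (m (frame + j) + side) w m = Some (c, m, 1) by apply: loadE; lia.
have e5 : Defs.add frame' j w m = Some (frame' + j, m, 1) by apply: addE; lia.
have e6 : store (frame' + j) c w m = Some (tt, upd m (frame' + j) c, 1).
  by apply: storeE; [lia | exact: mw].
(* This carries the hypotheses on the pointers still to be processed over to the updated memory. *)
have low a : a < frame' -> upd m (frame' + j) c a = m a.
  by move=> ha; rewrite /upd ifF //; lia.
have [|||i hi|m' [t [et ht h1 h2 h3]]] := IH j.+1 d (upd m (frame' + j) c) hd.
- by lia.
- by lia.
- by move=> a; rewrite /upd; case: ifP => _; exact: mw.
- by rewrite low; [apply: hp | ]; lia.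
exists m', (1 + (1 + (1 + (1 + (1 + (1 + (1 + (1 + t)))))))); split=> //.
- rewrite /= /bind /= ne e1 e2 e3 e4 e5 e6 addE; last by lia.
  by rewrite addn1 -(addSnnS j d) et.
- by lia.
- move=> i hi; have [ij|ij] := eqVneq i j.
    by rewrite ij h2 /upd ?eqxx //; lia.
  have hpi := hp i hi; rewrite h1; last by lia.
  by rewrite (low (frame + i)) ?low //; lia.
- move=> a ha; rewrite h2; last by lia.
  by rewrite /upd ifF //; lia.
Qed.

(** Same invariant as for [descendE], with a lookup in the table of roots in place of a move to a
    child. *)
Lemma load_rootsE w tbl qry frame n j d (m : memory) :
  d < n -> qry + (j + d) <= frame -> frame + (j + d) < 2 ^ w ->
  (forall a, m a < 2 ^ w) ->
  (forall i, j <= i < j + d -> tbl + m (qry + i) < frame) ->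
  exists m' t,
    [/\ load_roots n j (j + d) tbl qry frame w m = Some (tt, m', t),
        t <= 8 * d + 1,
        forall i, j <= i < j + d ->
          m' (frame + i) = m (tbl + m (qry + i)),
        forall a, ~~ (frame + j <= a < frame + (j + d)) -> m' a = m a
      & forall a, m' a < 2 ^ w].
Proof.
elim: n j d m => [//|n IH] j [|d] m hd hf hw mw hp.
  exists m, 1; split=> //; first by rewrite /= /bind /= addn0 eqxx.
  by move=> i; lia.
have ne : (j == j + d.+1) = false by lia.
have e1 : Defs.add qry j w m = Some (qry + j, m, 1) by apply: addE; lia.
have e2 : load (qry + j) w m = Some (m (qry + j), m, 1) by apply: loadE; lia.
have pj := hp j ltac:(lia).
have e3 : Defs.add tbl (m (qry + j)) w m = Some (tbl + m (qry + j), m, 1).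
  by apply: addE; lia.
set c := m (tbl + m (qry + j)).
have e4 : load (tbl + m (qry + j)) w m = Some (c, m, 1) by apply: loadE; lia.
have e5 : Defs.add frame j w m = Some (frame + j, m, 1) by apply: addE; lia.
have e6 : store (frame + j) c w m = Some (tt, upd m (frame + j) c, 1).
  by apply: storeE; [lia | exact: mw].
have low a : a < frame -> upd m (frame + j) c a = m a.
  by move=> ha; rewrite /upd ifF //; lia.
have [|||i hi|m' [t [et ht h1 h2 h3]]] := IH j.+1 d (upd m (frame + j) c) hd.
- by lia.
- by lia.
- by move=> a; rewrite /upd; case: ifP => _; exact: mw.
- by rewrite low; [apply: hp | ]; lia.
exists m', (1 + (1 + (1 + (1 + (1 + (1 + (1 + (1 + t)))))))); split=> //.
- rewrite /= /bind /= ne e1 e2 e3 e4 e5 e6 addE; last by lia.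
  by rewrite addn1 -(addSnnS j d) et.
- by lia.
- move=> i hi; have [ij|ij] := eqVneq i j.
    by rewrite ij h2 /upd ?eqxx //; lia.
  have hpi := hp i hi; rewrite h1; last by lia.
  by rewrite (low (qry + i)) ?low //; lia.
- move=> a ha; rewrite h2; last by lia.
  by rewrite /upd ifF //; lia.
Qed.

(** * Correctness and cost of the recursion *)

Definition alive (k : nat) (A : nat -> pred nat) (h L : nat) : bool :=
  all (fun j => occupied h L (A j)) (iota 0 k).

Lemma aliveP k A h L :
  reflect (forall j, j < k -> occupied h L (A j)) (alive k A h L).
Proof.
by apply: (iffP allP) => H j; have := H j; rewrite mem_iota add0n.
Qed.

Definition common (k : nat) (A : nat -> pred nat) : pred nat :=
  fun x => all (fun j => A j x) (iota 0 k).

Lemma commonP k (A : nat -> pred nat) x : reflect (forall j, j < k -> A j x) (common k A x).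
Proof.
by apply: (iffP allP) => H j; have := H j; rewrite mem_iota add0n.
Qed.

Definition commons k A h L := [seq x <- iota L (2 ^ h) | common k A x].

Lemma commons_dead k A h L : ~~ alive k A h L -> commons k A h L = [::].
Proof.
move/negP=> dead; apply/eqP; rewrite -[_ == _]negbK -has_filter.
apply/negP => /hasP[x hx /commonP cx]; apply: dead; apply/aliveP => j /cx Ax.
by apply/hasP; exists x.
Qed.

Lemma commons0 k A L : alive k A 0 L -> commons k A 0 L = [:: L].
Proof.
move/aliveP=> al; rewrite /commons /= ifT //; apply/commonP => j /al.
by rewrite /occupied /= orbF.
Qed.

Lemma commonsS k A h L :
  commons k A h.+1 L = commons k A h L ++ commons k A h (L + 2 ^ h).
Proof. by rewrite /commons iota_double filter_cat. Qed.

(* The number of recursive calls that find no empty set. *)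
Fixpoint visits (k : nat) (A : nat -> pred nat) (h L : nat) : nat :=
  if alive k A h L then
    (if h is h'.+1 then visits k A h' L + visits k A h' (L + 2 ^ h') else 0).+1
  else 0.

(** Occupancy excludes the null pointer, so [p] is an internal node and has two child cells. *)
Lemma trie_at_child (m : memory) bnd p h L A side :
  side < 2 -> occupied h.+1 L A -> trie_at m bnd p (subtrie h.+1 L A) ->
  p + side < bnd /\
  trie_at m bnd (m (p + side)) (subtrie h (L + side * 2 ^ h) A).
Proof.
rewrite /= => + -> /= /and4P[_ pb hl hr].
case: side => [|[|//]] _; rewrite ?mul0n ?mul1n ?addn0 ?addn1; split=> //.
exact: ltnW.
Qed.

Lemma descend_children w k A bnd frame n side (m : memory) h L :
  k < n -> bnd <= frame -> frame + k + k < 2 ^ w -> side < 2 ->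
  (forall a, m a < 2 ^ w) -> alive k A h.+1 L ->
  (forall j, j < k -> trie_at m bnd (m (frame + j)) (subtrie h.+1 L (A j))) ->
  exists m' t,
    [/\ descend n side 0 k frame (frame + k) w m = Some (tt, m', t),
        t <= 8 * k + 1,
        forall j, j < k ->
          trie_at m' bnd (m' (frame + k + j)) (subtrie h (L + side * 2 ^ h) (A j)),
        forall a, ~~ (frame + k <= a < frame + k + k) -> m' a = m a
      & forall a, m' a < 2 ^ w].
Proof.
move=> kn bf fw side2 mw /aliveP al tr.
have ch j (jk : j < k) := trie_at_child m bnd _ h L (A j) side side2 (al j jk) (tr j jk).
have [||i hi|m' [t [et ht h1 h2 h3]]] :=
  @descendE w side frame (frame + k) n 0 k m kn _ _ mw.
- by lia.
- by lia.
- by have [] := ch i hi; lia.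
exists m', t; split=> //; last by move=> a ha; apply: h2; lia.
move=> j jk; rewrite h1; last by lia.
apply: (@trie_at_eq m); last by have [] := ch j jk.
by move=> a ha; apply: h2; lia.
Qed.

(** Memory consists of the tries below [bnd], a stack with one frame per level up to [out0], and the
    output. A call keeps everything up to the end of its own frame, as well as the output already
    written. A dead call costs at most [5 * k + 2 <= 7 * k]. An alive internal call costs at most
    [21 * k + 9] by itself; adding [7 * k] for each of its two children gives
    [35 * k + 9 <= 44 * k]. The fuel covers one unit per level and the [k + 1] rounds of a loop. *)
Lemma tp_recE w k A bnd out0 h L n frame out (m : memory) :
  0 < k -> h + k + 1 < n -> bnd <= frame -> frame + h.+1 * k <= out0 ->
  out0 <= out -> out + size (commons k A h L) < 2 ^ w ->
  2 * (L + 2 ^ h) <= 2 ^ w -> (forall a, m a < 2 ^ w) ->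
  (forall j, j < k -> trie_at m bnd (m (frame + j)) (subtrie h L (A j))) ->
  exists m' t,
    [/\ tp_rec n k frame L (L + 2 ^ h) out w m =
          Some (out + size (commons k A h L), m', t),
        t <= 44 * k * visits k A h L + 7 * k,
        forall i, i < size (commons k A h L) ->
          m' (out + i) = nth 0 (commons k A h L) i,
        forall a, (a < frame + k) || (out0 <= a < out) -> m' a = m a
      & forall a, m' a < 2 ^ w].
Proof.
move=> k0; elim: h L n frame out m => [|h IH] L [|n] frame out m //.
  move=> kn bf fo oo ow Lw mw tr.
  have [|t0 [et0 ht0]] := @all_nonnullE w m frame n 0 k ltac:(lia); first by lia.
  have ne : all (fun i => m (frame + i) != 0) (iota 0 k) = alive k A 0 L.
    apply: eq_in_all => j; rewrite mem_iota => jk.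
    by apply: subtrie_null; apply: tr; lia.
  rewrite add0n ne in et0.
  case al : (alive k A 0 L) in et0 *; last first.
    rewrite (commons_dead _ _ _ _ (negbT al)) addn0.
    exists m, (1 + (t0 + 0)); split=> //; last by lia.
    by rewrite /= /bind /= et0 /=.
  rewrite (commons0 _ _ _ al) /= addn1 in ow *.
  have e1 : Defs.sub (L + 2 ^ 0) L w m = Some (L + 2 ^ 0 - L, m, 1).
    by apply: subE; lia.
  have e2 : store out L w m = Some (tt, upd m out L, 1) by apply: storeE; lia.
  have eb : (L + 2 ^ 0 - L == 1) by lia.
  exists (upd m out L), (1 + (t0 + (1 + (1 + (1 + 1))))); split.
  - by rewrite /= /bind /= et0 /= e1 /= eb e2 addE ?addn1 //; lia.
  - by rewrite al; nia.
  - by move=> [|//] _; rewrite addn0 /upd eqxx.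
  - by move=> a ha; rewrite /upd ifF //; lia.
  - by move=> a; rewrite /upd; case: ifP => _ //; lia.
move=> kn bf fo oo ow Lw mw tr.
have [|t0 [et0 ht0]] := @all_nonnullE w m frame n 0 k ltac:(lia); first by lia.
have ne : all (fun i => m (frame + i) != 0) (iota 0 k) = alive k A h.+1 L.
  apply: eq_in_all => j; rewrite mem_iota => jk.
  by apply: subtrie_null; apply: tr; lia.
rewrite add0n ne in et0.
case al : (alive k A h.+1 L) in et0 *; last first.
  rewrite (commons_dead _ _ _ _ (negbT al)) addn0.
  exists m, (1 + (t0 + 0)); split=> //; last by lia.
  by rewrite /= /bind /= et0 /=.
rewrite commonsS size_cat in ow *.
have p0 : 0 < 2 ^ h by rewrite expn_gt0.
have e2h : 2 ^ h.+1 = 2 ^ h + 2 ^ h by rewrite expnS; lia.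
set s1 := size (commons k A h L) in ow *.
set s2 := size (commons k A h _) in ow *.
have fk : frame + k + h.+1 * k <= out0 by lia.
have e1 : Defs.sub (L + 2 ^ h.+1) L w m = Some (L + 2 ^ h.+1 - L, m, 1).
  by apply: subE; lia.
have eb : (L + 2 ^ h.+1 - L == 1) = false by lia.
have e2 : Defs.add L (L + 2 ^ h.+1) w m = Some (L + (L + 2 ^ h.+1), m, 1).
  by apply: addE; lia.
have e3 : Defs.half (L + (L + 2 ^ h.+1)) w m = Some (L + 2 ^ h, m, 1).
  by rewrite halfE; [congr (Some (_, _, _)) | ]; lia.
have e4 : Defs.add frame k w m = Some (frame + k, m, 1).
  by apply: addE; nia.
have fw : frame + k + k < 2 ^ w by nia.
have [|m1 [t1 [et1 ht1 tr1 eq1 m1w]]] :=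
  @descend_children w k A bnd frame n 0 m h L _ bf fw isT mw al tr; first by lia.
rewrite mul0n addn0 in tr1.
have [||||||||m2 [t2 [et2 ht2 res2 eq2 m2w]]] := IH L n (frame + k) out m1 => //; try lia.
(* Neither the first descent nor the left call writes below [frame + k], so the second descent
   starts from the same node pointers. *)
have eq12 a : a < frame + k -> m2 a = m a by move=> ha; rewrite eq2 ?eq1 //; lia.
have tr2 j : j < k -> trie_at m2 bnd (m2 (frame + j)) (subtrie h.+1 L (A j)).
  move=> jk; rewrite eq12; last by lia.
  by apply: (@trie_at_eq m); [move=> a ha; apply: eq12; lia | exact: tr].
have [|m3 [t3 [et3 ht3 tr3 eq3 m3w]]] :=
  @descend_children w k A bnd frame n 1 m2 h L _ bf fw isT m2w al tr2; first by lia.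
rewrite mul1n in tr3.
have [||||||||m4 [t4 [et4 ht4 res4 eq4 m4w]]] :=
  IH (L + 2 ^ h) n (frame + k) (out + s1) m3 => //; try lia.
exists m4, (1 + (t0 + (1 + (1 + (1 + (1 + (1 + (t1 + (t2 + (t3 + t4)))))))))).
split=> //.
- rewrite /= /bind /= et0 /= e1 /= eb e2 e3 e4 et1 et2 et3 e2h addnA et4.
  by rewrite -/s2 (addnA out).
- rewrite /= al; nia.
(* The results of the left call lie above the stack, out of reach of the second descent, and in the
   part of the output that the right call preserves. *)
- move=> i hi; rewrite nth_cat -/s1; case: ifP => his.
    rewrite eq4; last by lia.
    rewrite eq3; last by nia.
    exact: res2.
  by rewrite -res4; [congr m4 | ]; lia.
- move=> a ha; rewrite eq4; last by lia.
  rewrite eq3; last by nia.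
  rewrite eq2; last by lia.
  by rewrite eq1 //; nia.
Qed.

(** * Counting the alive nodes level by level *)

(** Each visit is an alive node of some height [e]; the sum runs over all nodes of that height,
    whatever their ancestors. *)
Lemma visits_levels k A h L :
  visits k A h L <=
  \sum_(e < h.+1) \sum_(i < 2 ^ (h - e)) alive k A e (L + i * 2 ^ e).
Proof.
elim: h L => [|h IH] L.
  by rewrite big_ord1 subnn big_ord1 mul0n addn0 /=; case: ifP.
apply: (@leq_trans (alive k A h.+1 L + (visits k A h L + visits k A h (L + 2 ^ h)))).
  by rewrite [visits _ _ h.+1 _]/=; case: ifP.
rewrite big_ord_recr /= subnn big_ord1 mul0n addn0 addnC leq_add2r.
apply: (leq_trans (leq_add (IH L) (IH (L + 2 ^ h)))).
rewrite -big_split leq_sum //= => e _.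
have eh : e <= h by rewrite -ltnS.
(* The nodes of height [e] split into those of the left and of the right half; in the right half the
   index is shifted by [2 ^ (h - e)], that is, the range by [2 ^ h]. *)
rewrite subSn // expnS mul2n -addnn big_split_ord /= leq_add2l leq_sum // => i _.
by rewrite mulnDl -expnD subnK // addnA.
Qed.

Definition family {u N} (S : 'I_N -> {set 'I_u}) (sel : nat -> 'I_N) :
  nat -> pred nat := fun j => mem (elems (S (sel j))).

(* A live node is sent to the block containing the least point of its range.
   If two live nodes of one level had the same image, that block would contain
   the whole range of the left one as well as a further point; hence it would
   neither be a singleton nor miss any of the sets. *)
Lemma alive_level u N (S : 'I_N -> {set 'I_u}) (Q : {set 'I_N}) P k sel e n :
  partition_certificate S Q P -> 0 < k ->
  (forall q, q \in Q -> exists2 j, j < k & sel j = q) ->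
  \sum_(i < n) alive k (family S sel) e (i * 2 ^ e) <= #|P|.
Proof.
move=> [partP intP inP outP] k0 selQ.
have [/eqP covP trivP P0] := and3P partP.
have -> : \sum_(i < n) alive k (family S sel) e (i * 2 ^ e) =
          #|[set i : 'I_n | alive k (family S sel) e (i * 2 ^ e)]|.
  rewrite -sum1_card [RHS]big_mkcond; apply: eq_bigr => i _.
  by rewrite inE; case: (alive _ _ _ _).
set B := [set i : 'I_n | _].
have Bu (i : 'I_n) : i \in B -> i * 2 ^ e < u.
  rewrite inE => /aliveP/(_ 0 k0)/occupiedP[x hx /elemsP[y _ xy]].
  by have := ltn_ord y; lia.
have [->|[i0 i0B]] := finset.set_0Vmem B; first by rewrite finset.cards0.
(* The point of [i0] is only a default value: by [ptE] it is not taken on [B]. *)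
pose pt (i : 'I_n) : 'I_u := insubd (Ordinal (Bu i0 i0B)) (i * 2 ^ e).
have ptE i : i \in B -> pt i = i * 2 ^ e :> nat.
  by move=> iB; rewrite /pt val_insubd Bu.
have inblk x : x \in finset.pblock P x by rewrite finset.mem_pblock covP.
have blkP x : finset.pblock P x \in P by rewrite finset.pblock_mem ?covP.
rewrite -(@card_in_imset _ _ (fun i => finset.pblock P (pt i))); last first.
  suff main (i j : 'I_n) : i \in B -> j \in B -> i < j ->
      finset.pblock P (pt i) <> finset.pblock P (pt j).
    move=> i j iB jB /= eqP; apply/val_inj; case: (ltngtP i j) => // lt.
      by case: (main _ _ iB jB lt).
    by case: (main _ _ jB iB lt).
  move=> iB jB ij eqb; have ei := ptE i iB; have ej := ptE j jB.
  have lt : pt i + 2 ^ e <= pt j.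
    by rewrite ei ej; have := leq_mul ij (leqnn (2 ^ e)); lia.
  have p0 : 0 < 2 ^ e by rewrite expn_gt0.
  have ji : pt j \in finset.pblock P (pt i) by rewrite eqb.
  have [/inP s1|/outP[I [IP iI [q [qQ dis]]]]] := boolP (pt i \in inter S Q).
    move: ji; rewrite (finset.def_pblock trivP s1) ?finset.set11 // => /finset.set1P eqij.
    by move: lt; rewrite eqij; lia.
  rewrite (finset.def_pblock trivP IP iI) in ji.
  have [a [b defI]] := intP I IP.
  have [s sk sq] := selQ q qQ.
  (* The range of [i] ends before [pt j], so its point of [S q] lies between [pt i] and [pt j],
     hence in the interval [I]. *)
  move: (iB); rewrite inE => /aliveP/(_ s sk)/occupiedP[x hx /elemsP[y yS xy]].
  have : y \in S q :&: I.
    rewrite !inE; apply/andP; split; first by rewrite -sq.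
    by move: iI ji; rewrite defI !inE; lia.
  by rewrite dis inE.
by rewrite subset_leq_card //; apply/fintype.subsetP => _ /imsetP[i _ ->].
Qed.

(** The terms of index below [D] form a geometric sum below [2 ^ D]; each of the others is at most
    [d]. *)
Lemma sum_minn_exp2 n D d : 2 ^ D <= d ->
  \sum_(i < n) minn (2 ^ i) d <= 2 ^ D + (n - D) * d.
Proof.
have lt_exp m : \sum_(i < m) minn (2 ^ i) d < 2 ^ m.
  elim: m => [|m IH]; first by rewrite big_ord0.
  by rewrite big_ord_recr expnS mul2n -addnn -addSn leq_add ?geq_minl.
move=> Dd; elim: n => [|n IH]; first by rewrite big_ord0.
have [nD|Dn] := ltnP n D.
  by rewrite (leq_trans (ltnW (lt_exp _))) // (leq_trans _ (leq_addr _ _)) // leq_exp2l.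
by rewrite big_ord_recr subSn // mulSn addnCA addnC leq_add ?geq_minr.
Qed.

Lemma visits_certificate u N (S : 'I_N -> {set 'I_u}) (Q : {set 'I_N}) P k sel H D :
  partition_certificate S Q P -> 0 < k ->
  (forall q, q \in Q -> exists2 j, j < k & sel j = q) ->
  D <= H -> 2 ^ D <= #|P| ->
  visits k (family S sel) H 0 <= #|P| * (H - D + 2).
Proof.
move=> certP k0 selQ DH DP.
apply: leq_trans (visits_levels _ _ _ _) _.
apply: (@leq_trans (\sum_(e < H.+1) minn (2 ^ (H - e)) #|P|)).
  apply: leq_sum => e _; rewrite leq_min; apply/andP; split.
    rewrite -[leqRHS]card_ord -sum1_card leq_sum // => i _; exact: leq_b1.
  exact: (alive_level _ _ _ _ _ _ _ _ _ certP k0 selQ).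
(* The sum now runs over the depths instead of the heights. *)
rewrite (reindex_inj rev_ord_inj) /=.
under eq_bigr => e _ do rewrite subSS subKn -1?ltnS //.
apply: leq_trans (sum_minn_exp2 _ _ _ DP) _; by rewrite subSn // [_.+1 * _]mulnC addn2 [leqRHS]mulnS leq_add2r.
Qed.

(** * From the number of levels to [lg (u / delta)] *)

(** Blocks are nonempty and disjoint, which bounds their number by that of the points; the block of
    the point 0 shows that there is one. *)
Lemma card_certificate u N (S : 'I_N -> {set 'I_u}) (Q : {set 'I_N}) P :
  0 < u -> partition_certificate S Q P -> 0 < #|P| <= u.
Proof.
move=> u0 [partP _ _ _]; have [/eqP covP trivP P0] := and3P partP.
apply/andP; split.
  apply/card_gt0P; exists (finset.pblock P (Ordinal u0)).
  by rewrite finset.pblock_mem // covP.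
rewrite -[leqRHS]card_ord -finset.cardsT (card_partition partP) -sum1_card.
apply: leq_sum => I IP; rewrite card_gt0; apply: contraNneq P0 => <-; exact: IP.
Qed.

Lemma exp_height_lt u : 0 < u -> 2 ^ height u < 2 * u.
Proof.
case: u => [//|[|u]] _ //; have /andP[+ _] := up_log_bounds (isT : 1 < 2) (isT : 1 < u.+2).
rewrite /height; have := up_log_gt0 2 u.+2; case: (up_log _ _) => [|h] //= _.
by rewrite expnS ltn_pmul2l.
Qed.

Local Open Scope ring_scope.

(** With [H] the height and [D] the truncated logarithm of [d], the bounds [2 ^ H < 2 * u] and
    [d < 2 ^ D.+1] give [2 ^ (H - D) * d <= 4 * u]. So [H - D] is at most [2 + lg (u / d)], and the
    left side at most [4 + lg (u / d)], whence the factor 5. *)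
Lemma levels_lg (R : realType) (u d : nat) : (0 < d <= u)%N ->
  (height u - trunc_log 2 d + 2)%N%:R <=
  5 * Num.max 1 (lg (u%:R / d%:R)) :> R.
Proof.
move=> /andP[d0 du]; move DE : (trunc_log 2 d) => D.
have u0 : (0 < u)%N by apply: leq_trans du.
have Dd : (2 ^ D <= d)%N by rewrite -DE trunc_logP.
have dD : (d < 2 ^ D.+1)%N by rewrite -DE trunc_log_ltn.
have DH : (D <= height u)%N.
  by rewrite -(leq_exp2l _ _ (isT : (1 < 2)%N)) (leq_trans Dd) // (leq_trans du) // leq_height.
have key : (2 ^ (height u - D) * d <= 2 ^ 2 * u)%N.
  have Hu := exp_height_lt u u0.
  have e : (2 ^ height u = 2 ^ (height u - D) * 2 ^ D)%N by rewrite -expnD subnK.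
  move: Hu dD; rewrite e expnS.
  set a := (2 ^ _)%N; set b := (2 ^ D)%N => Hu dD; nia.
have ln2 : 0 < ln (2 : R) by apply: ln_gt0; lra.
have lnX n : ln ((2 : R) ^+ n) = n%:R * ln 2 by rewrite lnXn ?mulr_natl.
have dR : 0 < d%:R :> R by rewrite ltr0n.
have uR : 0 < u%:R :> R by rewrite ltr0n.
have : ln ((2 : R) ^+ (height u - D)) <= ln (2 ^+ 2 * (u%:R / d%:R)).
  rewrite ler_ln ?posrE ?exprn_gt0 ?mulr_gt0 ?invr_gt0 ?exprn_gt0 //.
  by rewrite mulrA ler_pdivlMr // -!natrX -!natrM ler_nat.
rewrite lnM ?posrE ?exprn_gt0 ?mulr_gt0 ?invr_gt0 // (lnX (height u - D)%N) (lnX 2%N).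
move=> bnd.
have : (height u - D)%N%:R <= 2 + lg (u%:R / d%:R : R).
  by rewrite /lg -(ler_pM2r ln2) mulrDl divfK ?lt0r_neq0.
rewrite natrD; move: (_ - _)%N (lg _) => n x hx.
have [] : 1 <= Num.max 1 x /\ x <= Num.max 1 x by rewrite !le_max !lexx orbT.
lra.
Qed.

Local Close Scope ring_scope.

(** * The whole algorithm and its running time *)

Lemma commons_inter u N (S : 'I_N -> {set 'I_u}) (Q : {set 'I_N}) k sel :
  0 < k -> (forall j, j < k -> sel j \in Q) ->
  (forall q, q \in Q -> exists2 j, j < k & sel j = q) ->
  perm_eq (commons k (family S sel) (height u) 0) (elems (inter S Q)).
Proof.
move=> k0 selin selQ; apply: uniq_perm.
- by rewrite filter_uniq ?iota_uniq.
- exact: elems_uniq.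
move=> x; rewrite mem_filter mem_iota add0n leq0n /=.
apply/andP/elemsP => [[/commonP cx _]|[y /bigcapP yI ->]]; last first.
  split; last exact: leq_trans (ltn_ord y) (leq_height u).
  by apply/commonP => j jk; rewrite /family /= mem_elems; apply/yI/selin.
have /elemsP[y _ xy] := cx 0 k0; exists y => //; apply/bigcapP => q /selQ[j jk <-].
by have := cx j jk; rewrite xy /family /= mem_elems.
Qed.

(** The function [sel] lists the queried indices in the order of the query array; that it reaches
    all of [Q] is what the counting by certificates requires. Loading the roots and the term [7 * k]
    of the recursion cost at most [15 * k + 1 <= 16 * k], where [k] is the size of [Q]. *)
Lemma tp_intersectionE w u N (S : 'I_N -> {set 'I_u}) (Q : {set 'I_N}) m tbl qry stk out :
  Q != finset.set0 -> stored w S Q m tbl qry stk out ->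
  exists fuel m' t sel,
    [/\ tp_intersection fuel #|Q| (2 ^ height u) tbl qry stk out w m
          = Some (out + #|inter S Q|, m', t),
        perm_eq [seq m' (out + j) | j <- iota 0 #|inter S Q|] (elems (inter S Q)),
        forall q, q \in Q -> exists2 j, j < #|Q| & sel j = q
      & t <= 16 * #|Q| + 44 * #|Q| * visits #|Q| (family S sel) (height u) 0].
Proof.
move=> Q0 [mw [tblN tries] [qrys permQ] stack outw univ].
have k0 : 0 < #|Q| by rewrite card_gt0.
have /finset.set0Pn[i0 i0Q] := Q0.
(* For [j < #|Q|] the cell holds an index of [Q], so the default [i0] is not taken. *)
pose sel j : 'I_N := insubd i0 (m (qry + j)).
have selP j : j < #|Q| -> m (qry + j) = sel j /\ sel j \in Q.
  move=> jk.
  have : m (qry + j) \in [seq val i | i <- enum Q].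
    by rewrite -(perm_mem permQ) (map_f (fun j => m (qry + j))) // mem_iota.
  by case/mapP=> i; rewrite mem_enum => iQ e; rewrite /sel e valKd.
have selQ q : q \in Q -> exists2 j, j < #|Q| & sel j = q.
  move=> qQ; have : val q \in [seq m (qry + j) | j <- iota 0 #|Q|].
    by rewrite (perm_mem permQ) map_f ?mem_enum.
  case/mapP=> j; rewrite mem_iota => jk e; exists j => //.
  by rewrite /sel -e valKd.
have selin j (jk : j < #|Q|) := (selP j jk).2.
have permI := commons_inter u N S Q #|Q| sel k0 selin selQ.
have sizeI : size (commons #|Q| (family S sel) (height u) 0) = #|inter S Q|.
  by rewrite (perm_size permI) size_map -cardE.
have stkw : stk + #|Q| < 2 ^ w by nia.
have [||||i hi|m1 [t1 [et1 ht1 h1 eq1 m1w]]] :=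
  @load_rootsE w tbl qry stk (height u + #|Q| + 2) 0 #|Q| m => //; try lia.
  by have [-> _] := selP i hi; have := ltn_ord (sel i); lia.
have [||||||j jk|m2 [t2 [et2 ht2 res2 _ _]]] :=
  @tp_recE w #|Q| (family S sel) stk out (height u) 0 (height u + #|Q| + 2) stk out m1
    k0 _ _ _ _ _ _ m1w => //; rewrite ?sizeI; try lia.
  rewrite h1 ?jk // (selP j jk).1.
  apply: (@trie_at_eq m); first by move=> a ha; apply: eq1; lia.
  by rewrite -bintrie_subtrie.
rewrite add0n in et1 et2; rewrite sizeI in et2 res2.
exists (height u + #|Q| + 2), m2, (t1 + t2), sel; split=> //.
- by rewrite /tp_intersection /bind et1 et2.
- rewrite (_ : map _ _ = commons #|Q| (family S sel) (height u) 0) //.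
  rewrite -[RHS](mkseq_nth 0) sizeI; apply/eq_in_map => j.
  by rewrite mem_iota => /res2.
- by lia.
Qed.

Theorem theorem3p2 (R : realType) (W : nat -> nat)
    (hW : (fun u : nat => ((W u)%:R)%R : R) =Theta_(\oo%classic)
          (fun u : nat => lg (u%:R)%R : R)) :
  exists c : R,
  forall (u N : nat) (S : 'I_N -> {set 'I_u}) (Q : {set 'I_N}) (delta : nat)
         (m : memory) (tbl qry stk out : nat),
    0 < u -> Q != finset.set0 ->
    alternation_measure S Q delta ->
    stored (W u) S Q m tbl qry stk out ->
    exists (fuel : nat) (m' : memory) (t : nat),
      [/\ tp_intersection fuel #|Q| (2 ^ height u) tbl qry stk out (W u) m
            = Some (out + #|inter S Q|, m', t),
          perm_eq [seq m' (out + j) | j <- iota 0 #|inter S Q|]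
                  [seq val x | x <- enum (inter S Q)]
        & (t%:R <= c * #|Q|%:R * delta%:R
                   * Num.max 1 (lg (u%:R / delta%:R)))%R].
Proof.
(* The constant is [16 + 44 * 5]: 16 and 44 come from the cost of the run, 5 from [levels_lg]. The
   measure [delta] is attained by a certificate [P]. *)
exists (236%:R)%R => u N S Q delta m tbl qry stk out u0 Q0 [[P [certP <-]] _] st.
have [fuel [m' [t [sel [run res selQ ht]]]]] := tp_intersectionE _ _ _ _ _ _ _ _ _ _ Q0 st.
exists fuel, m', t; split=> //.
have k0 : 0 < #|Q| by rewrite card_gt0.
have Pu := card_certificate _ _ _ _ _ u0 certP.
have [P0 Pleu] := andP Pu.
have DP : 2 ^ trunc_log 2 #|P| <= #|P| by rewrite trunc_logP.
have DH : trunc_log 2 #|P| <= height u.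
  by rewrite -(leq_exp2l _ _ (isT : 1 < 2)) (leq_trans DP) // (leq_trans Pleu) // leq_height.
have vis := visits_certificate _ _ _ _ _ _ _ _ _ certP k0 selQ DH DP.
have lev := levels_lg R u #|P| Pu.
set x := Num.max _ _ in lev *.
have x1 : (1 <= x)%R by rewrite /x le_max lexx.
move: vis lev ht; move: (_ - _ + 2) (visits _ _ _ _) => n v vis lev ht.
(* The term [16 * #|Q|] is absorbed because [P] has at least one block. *)
have {}ht : t <= #|Q| * #|P| * (16 + 44 * n).
  apply: leq_trans ht _; apply: (@leq_trans (16 * #|Q| + 44 * #|Q| * (#|P| * n))).
    by rewrite leq_add2l leq_mul2l vis orbT.
  have : #|Q| <= #|Q| * #|P| by rewrite leq_pmulr.
  by lia.
apply: (@le_trans _ _ (#|Q|%:R * #|P|%:R * (16 + 44 * n%:R))%R).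
  by move: ht; rewrite -(ler_nat R) !natrM natrD natrM.
rewrite (_ : 236%:R * _ * _ * x = #|Q|%:R * #|P|%:R * (236 * x))%R; last by ring.
rewrite ler_wpM2l ?mulr_ge0 //; lra.
Qed.
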